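(* Let $(L,[-,-,-])$ be a ternary Leibniz algebra, let $(V,\lambda,\mu,\rho)$ be a representation of $L$ on a vector space $V$, and let $T:V\to L$ be an $O$-operator on $L$ with respect to $(V,\lambda,\mu,\rho)$. Define $[-,-,-]_T:V\times V\times V\to V$ by $$[u_1,u_2,u_3]_T=\lambda(T(u_1),T(u_2))(u_3)+\mu(T(u_1),T(u_3))(u_2)+\rho(T(u_2),T(u_3))(u_1)$$ for all $u_1,u_2,u_3\in V$. Then $(V,[-,-,-]_T)$ is a ternary Leibniz algebra. Moreover, let $T'$ be another $O$-operator on $(L,[-,-,-])$ with respect to the same representation $(V,\lambda,\mu,\rho)$, and let $(f,\varphi)$ be a morphism of $O$-operators from $T'$ to $T$. Then $\varphi$ is a homomorphism of ternary Leibniz algebras from $(V,[-,-,-]_{T'})$ to $(V,[-,-,-]_T)$.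
   Context: Vector spaces are over a field $\mathbb{K}$. A ternary Leibniz algebra is a vector space $L$ with a trilinear map $[-,-,-]:L\times L\times L\to L$ such that $[[x,y,z],t,u]=[x,y,[z,t,u]]+[x,[y,t,u],z]+[[x,t,u],y,z]$ for all $x,y,z,t,u\in L$. A homomorphism of ternary Leibniz algebras is a linear map preserving the brackets. A representation $(V,\lambda,\mu,\rho)$ of a ternary Leibniz algebra $L$ on a vector space $V$ consists of three bilinear maps $\lambda,\mu,\rho:L\times L\to \mathrm{End}(V)$ such that for all $x,y,z,t\in L$: $$\lambda([x,y,z],t)=\lambda(x,y)\lambda(z,t)+\mu(x,z)\lambda(y,t)+\rho(y,z)\lambda(x,t),$$ $$\mu([x,y,z],t)=\lambda(x,y)\mu(z,t)+\mu(x,z)\mu(y,t)+\rho(y,z)\mu(x,t),$$ $$\rho(z,t)\lambda(x,y)=\lambda(x,y)\rho(z,t)+\lambda(x,[y,z,t])+\lambda([x,z,t],y),$$ $$\rho(z,t)\mu(x,y)=\mu(x,[y,z,t])+\mu(x,y)\rho(z,t)+\mu([x,z,t],y),$$ $$\rho(z,t)\rho(x,y)=\rho(x,[y,z,t])+\rho([x,z,t],y)+\rho(x,y)\rho(z,t).$$ A linear map $T:V\to L$ is an $O$-operator on $L$ with respect to $(V,\lambda,\mu,\rho)$ if for all $u,v,w\in V$, $$[T(u),T(v),T(w)]=T\big(\lambda(T(u),T(v))w+\mu(T(u),T(w))v+\rho(T(v),T(w))u\big).$$ A morphism from an $O$-operator $T'$ to an $O$-operator $T$ (both with respect to $(V,\lambda,\mu,\rho)$)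 is a pair $(f,\varphi)$, where $f:L\to L$ is a ternary Leibniz algebra morphism and $\varphi:V\to V$ is a linear map, such that $T\circ\varphi=f\circ T'$ and, for all $x,y\in L$, $u\in V$: $\varphi(\lambda(x,y)u)=\lambda(f(x),f(y))\varphi(u)$, $\varphi(\mu(x,y)u)=\mu(f(x),f(y))\varphi(u)$, $\varphi(\rho(x,y)u)=\rho(f(x),f(y))\varphi(u)$. *)

(* Defs.v *)
From HB Require Import structures.
From mathcomp Require Import all_boot all_order all_algebra.

Set Implicit Arguments.
Unset Strict Implicit.
Unset Printing Implicit Defensive.

Import GRing.Theory.
Local Open Scope ring_scope.

Definition trilinear (K : fieldType) (L : lmodType K) (br : L -> L -> L -> L) :
    Prop :=
  [/\ forall y z, linear (fun x => br x y z),
      forall x z, linear (fun y => br x y z)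
    & forall x y, linear (fun z => br x y z)].

Definition ternary_leibniz_identity (K : fieldType) (L : lmodType K)
    (br : L -> L -> L -> L) : Prop :=
  forall x y z t u,
    br (br x y z) t u =
    br x y (br z t u) + br x (br y t u) z + br (br x t u) y z.

Definition ternary_leibniz_algebra (K : fieldType) (L : lmodType K)
    (br : L -> L -> L -> L) : Prop :=
  trilinear br /\ ternary_leibniz_identity br.

Definition ternary_leibniz_hom (K : fieldType) (L M : lmodType K)
    (brL : L -> L -> L -> L) (brM : M -> M -> M -> M)
    (f : {linear L -> M}) : Prop :=
  forall x y z, f (brL x y z) = brM (f x) (f y) (f z).

(* The vector space structure of End(V) is pointwise, so bilinearity of
   L x L -> End(V) is stated after evaluation at an arbitrary vector. *)
Definition bilinear_to_End (K : fieldType) (L V : lmodType K)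
    (a : L -> L -> {linear V -> V}) : Prop :=
  (forall y v, linear (fun x => a x y v)) /\
  (forall x v, linear (fun y => a x y v)).

(* Products in End(V) are compositions, and equalities in End(V) are stated
   pointwise. *)
Record ternary_leibniz_rep (K : fieldType) (L V : lmodType K)
    (br : L -> L -> L -> L) (lam mu rho : L -> L -> {linear V -> V}) : Prop :=
  TernaryLeibnizRep {
    rep_lam_bilinear : bilinear_to_End lam;
    rep_mu_bilinear : bilinear_to_End mu;
    rep_rho_bilinear : bilinear_to_End rho;
    rep_lam_bracket : forall x y z t v,
      lam (br x y z) t v =
      lam x y (lam z t v) + mu x z (lam y t v) + rho y z (lam x t v);
    rep_mu_bracket : forall x y z t v,
      mu (br x y z) t v =
      lam x y (mu z t v) + mu x z (mu y t v) + rho y z (mu x t v);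
    rep_rho_lam : forall x y z t v,
      rho z t (lam x y v) =
      lam x y (rho z t v) + lam x (br y z t) v + lam (br x z t) y v;
    rep_rho_mu : forall x y z t v,
      rho z t (mu x y v) =
      mu x (br y z t) v + mu x y (rho z t v) + mu (br x z t) y v;
    rep_rho_rho : forall x y z t v,
      rho z t (rho x y v) =
      rho x (br y z t) v + rho (br x z t) y v + rho x y (rho z t v)
  }.

Definition O_bracket (K : fieldType) (L V : lmodType K)
    (lam mu rho : L -> L -> {linear V -> V}) (T : {linear V -> L})
    (u1 u2 u3 : V) : V :=
  lam (T u1) (T u2) u3 + mu (T u1) (T u3) u2 + rho (T u2) (T u3) u1.

Definition O_operator (K : fieldType) (L V : lmodType K)
    (br : L -> L -> L -> L) (lam mu rho : L -> L -> {linear V -> V})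
    (T : {linear V -> L}) : Prop :=
  forall u v w : V,
    br (T u) (T v) (T w) =
    T (lam (T u) (T v) w + mu (T u) (T w) v + rho (T v) (T w) u).

(* A morphism (f, phi) from the O-operator T' to the O-operator T. *)
Record O_operator_morphism (K : fieldType) (L V : lmodType K)
    (br : L -> L -> L -> L) (lam mu rho : L -> L -> {linear V -> V})
    (T' T : {linear V -> L}) (f : {linear L -> L}) (phi : {linear V -> V}) :
    Prop :=
  OOperatorMorphism {
    O_morph_hom : ternary_leibniz_hom br br f;
    O_morph_comm : forall u, T (phi u) = f (T' u);
    O_morph_lam : forall x y u, phi (lam x y u) = lam (f x) (f y) (phi u);
    O_morph_mu : forall x y u, phi (mu x y u) = mu (f x) (f y) (phi u);
    O_morph_rho : forall x y u, phi (rho x y u) = rho (f x) (f y) (phi u)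
  }.

(* Main.v *)
Require Import Defs.
From HB Require Import structures.
From mathcomp Require Import all_boot all_order all_algebra.

(** A representation of [L] on [V] is the same thing as a ternary Leibniz
    algebra structure on [L (+) V] extending that of [L], in which the bracket
    of a triple containing one entry [v] of [V] is [lam x y v], [mu x y v] or
    [rho x y v], according to whether [v] comes third, second or first, and
    brackets with two or more entries in [V] vanish.  The five action identities
    are the Leibniz identity of [L (+) V] with one of its five arguments in
    [V].  The operator condition says that the graph of [T] is a subalgebra,
    and [O_bracket] is the bracket of this graph transported to [V].

    Concretely, [T] sends [O_bracket] to the bracket of [L].  Hence, in the
    Leibniz identity for [O_bracket] at [x, y, z, t, u], every nested bracket
    occurring under [T] becomes a bracket of [L], and each side is a sum of
    five groups of terms, one for each argument that is left in [V].  The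
    group of each argument is balanced by one of the five action identities;
    this is [O_bracket_leibniz].

    A morphism of operators preserves the three actions and intertwines the
    operators, so [phi] carries each of the three terms of [O_bracket] for the
    source to the corresponding term for the target. *)

Set Implicit Arguments.
Unset Strict Implicit.
Unset Printing Implicit Defensive.

Import GRing.Theory.
Local Open Scope ring_scope.

Lemma O_bracket_trilinear (K : fieldType) (L V : lmodType K)
    (lam mu rho : L -> L -> {linear V -> V}) (T : {linear V -> L}) :
  bilinear_to_End lam -> bilinear_to_End mu -> bilinear_to_End rho ->
  trilinear (O_bracket lam mu rho T).
Proof.
move=> [laml lamr] [mul mur] [rhol rhor].
split=> v w a u u'; rewrite /O_bracket !linearP.
- by rewrite laml mul !scalerDr [LHS](AC (2*2*2) ((1*3*5)*(2*4*6))).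
- by rewrite lamr rhol !scalerDr [LHS](AC (2*2*2) ((1*3*5)*(2*4*6))).
- by rewrite mur rhor !scalerDr [LHS](AC (2*2*2) ((1*3*5)*(2*4*6))).
Qed.

(** Once the nested brackets under [T] are brackets of [L], the left-hand side
    has one term with [u] and one with [t] outside [T], split in three by
    [rep_lam_bracket] and [rep_mu_bracket]; its terms in [z], [y], [x] have
    [rho (T t) (T u)] in front, which is moved past [lam], [mu], [rho] by
    [rep_rho_lam], [rep_rho_mu], [rep_rho_rho].  The fifteen resulting terms
    are those of the right-hand side. *)
Lemma O_bracket_leibniz (K : fieldType) (L V : lmodType K)
    (br : L -> L -> L -> L) (lam mu rho : L -> L -> {linear V -> V})
    (T : {linear V -> L}) :
  ternary_leibniz_rep br lam mu rho -> O_operator br lam mu rho T ->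
  ternary_leibniz_identity (O_bracket lam mu rho T).
Proof.
move=> hV hT x y z t u.
pose brT := O_bracket lam mu rho T; rewrite -/brT.
have brTE a b c : brT a b c =
  lam (T a) (T b) c + mu (T a) (T c) b + rho (T b) (T c) a by [].
have T_brT a b c : T (brT a b c) = br (T a) (T b) (T c) by rewrite hT.
(* Only the outer brackets are unfolded, so that the nested ones that occur
   under T can first be turned into brackets of L. *)
rewrite (brTE (brT _ _ _)) (brTE _ _ (brT _ _ _)) (brTE _ (brT _ _ _)).
rewrite (brTE (brT _ _ _)) !T_brT !brTE !linearD /=.
rewrite (rep_lam_bracket hV) (rep_mu_bracket hV).
rewrite (rep_rho_lam hV _ _ (T t) (T u)) (rep_rho_mu hV _ _ (T t) (T u)).
rewrite (rep_rho_rho hV _ _ (T t) (T u)).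
(* The left-hand side is now five consecutive triples, for the arguments
   u, t, z, y, x; the right-hand side takes one term from each of them in each
   of its three brackets. *)
by rewrite [LHS](AC (3*3*(3*3*3))
  ((1*4*7*10*13)*(8*(2*5*11)*14)*(9*12*(3*6*15)))).
Qed.

Lemma O_bracket_hom (K : fieldType) (L V : lmodType K)
    (br : L -> L -> L -> L) (lam mu rho : L -> L -> {linear V -> V})
    (T' T : {linear V -> L}) (f : {linear L -> L}) (phi : {linear V -> V}) :
  O_operator_morphism br lam mu rho T' T f phi ->
  ternary_leibniz_hom (O_bracket lam mu rho T') (O_bracket lam mu rho T) phi.
Proof.
move=> [_ Tphi phi_lam phi_mu phi_rho] u v w.
by rewrite /O_bracket !linearD /= phi_lam phi_mu phi_rho !Tphi.
Qed.

Theorem theorem3p3 (K : fieldType) (L V : lmodType K)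
    (br : L -> L -> L -> L) (lam mu rho : L -> L -> {linear V -> V})
    (T : {linear V -> L})
    (hL : ternary_leibniz_algebra br)
    (hV : ternary_leibniz_rep br lam mu rho)
    (hT : O_operator br lam mu rho T) :
  ternary_leibniz_algebra (O_bracket lam mu rho T) /\
  (forall (T' : {linear V -> L}) (f : {linear L -> L}) (phi : {linear V -> V}),
     O_operator br lam mu rho T' ->
     O_operator_morphism br lam mu rho T' T f phi ->
     ternary_leibniz_hom
       (O_bracket lam mu rho T') (O_bracket lam mu rho T) phi).
Proof.
split; last by move=> T' f phi _; apply: O_bracket_hom.
split; last exact: O_bracket_leibniz hV hT.
by case: hV => *; apply: O_bracket_trilinear.
Qed.
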